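(* Let $n\ge1$. Order $\mathrm{Par}(n)$ by $\mu\preceq\lambda$ iff $\mu^\vee\le_{\mathrm{lex}}\lambda^\vee$. Then the matrix $(A(\lambda,\mu))_{\lambda,\mu\in\mathrm{Par}(n)}$, where $A(\lambda,\mu)=|\mathcal{D}(\mathbb{J}_\lambda,J_\mu)|$, written with respect to this total order is upper-triangular with $1$'s on the diagonal. Equivalently, for $\lambda,\mu\in\mathrm{Par}(n)$: (1) if $\mu\prec\lambda$ then $\mathcal{D}(\mathbb{J}_\lambda,J_\mu)=\emptyset$, so $A(\lambda,\mu)=0$; (2) $\mathcal{D}(\mathbb{J}_\lambda,J_\lambda)$ has exactly one element, so $A(\lambda,\lambda)=1$.
   Context: $\mathrm{Par}(n)$ is the set of partitions of $n$; $\lambda^\vee$ denotes the dual (conjugate) partition and $\le_{\mathrm{lex}}$ the lexicographic order on sequences. $\Delta=\{\alpha_1,\dots,\alpha_{n-1}\}$ (simple roots, $\alpha_j=t_j-t_{j+1}$). For $w\in\mathfrak{S}_n$: $\mathrm{Des}_L(w)=\{\alpha_j:w^{-1}(j)>w^{-1}(j+1)\}$, $\mathrm{Des}_R(w)=\{\alpha_j:w(j)>w(j+1)\}$. For $J,K\subseteq\Delta$, $\mathcal{D}(J,K)=\{w\in\mathfrak{S}_n:\mathrm{Des}_L(w)=\Delta\setminus J,\ \mathrm{Des}_R(w)\subseteq\Delta\setminus K\}$. For $\mu=(\mu_1,\dots,\mu_k)\vdash n$ with $k$ parts, $J_\mu=\Delta\setminus\{\alpha_{\mu_1},\alpha_{\mu_1+\mu_2},\dots,\alpha_{\mu_1+\cdots+\mu_{k-1}}\}$,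 and $\mathbb{J}_\lambda=\Delta\setminus J_{\lambda^\vee}$. *)

(* Defs.v *)
From HB Require Import structures.
From mathcomp Require Import all_boot all_order all_fingroup all_algebra.

Set Implicit Arguments.
Unset Strict Implicit.
Unset Printing Implicit Defensive.

(* Partitions of n: weakly decreasing sequences of positive integers with
   sum n (no trailing zeros, so [size] is the number of parts). *)

Definition is_part (n : nat) (s : seq nat) : bool :=
  [&& sorted geq s, all (fun x => 0 < x) s & sumn s == n].

Record Par (n : nat) := MkPar { parts :> seq nat; _ : is_part n parts }.

HB.instance Definition _ n := [isSub for @parts n].
HB.instance Definition _ n := [Countable of Par n by <:].

Lemma is_part_size n s : is_part n s -> size s <= n.
Proof.
case/and3P=> _ + /eqP<-; elim: s => //= x s IHs /andP[x0 /IHs].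
by rewrite -add1n; apply: leq_add.
Qed.

Lemma is_part_le n s x : is_part n s -> x \in s -> x <= n.
Proof.
case/and3P=> _ _ /eqP<-; elim: s => //= y s IHs.
rewrite inE => /predU1P[->|/IHs H]; first exact: leq_addr.
exact: leq_trans H (leq_addl _ _).
Qed.

(* Both the length and the parts of a partition of n are at most n, whence
   the finiteness of Par n. *)
Definition Par_code n (la : Par n) : n.-bseq 'I_n.+1 :=
  insub_bseq n [seq inord x | x <- parts la].
Definition Par_decode n (b : n.-bseq 'I_n.+1) : option (Par n) :=
  insub [seq val i | i <- b].

Lemma Par_codeK n : pcancel (@Par_code n) (@Par_decode n).
Proof.
move=> la; have Pla := valP la.
rewrite /Par_decode /Par_code /insub_bseq val_insubd size_map.
rewrite (is_part_size Pla) -map_comp.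
rewrite (_ : map _ _ = parts la) ?valK // -[RHS]map_id.
apply/eq_in_map => x xla /=.
by rewrite inordK // ltnS (is_part_le Pla xla).
Qed.

HB.instance Definition _ n :=
  isFinite.Build (Par n) (pcan_enumP (@Par_codeK n)).

(* The i-th part (counted from 1) of the dual is #{j : i <= la_j}. *)
Definition dual_seq (s : seq nat) : seq nat :=
  [seq count (fun x => i < x) s | i <- iota 0 (head 0 s)].

Lemma sorted_geq_head s x : sorted geq s -> x \in s -> x <= head 0 s.
Proof.
case: s => //= y s; rewrite (path_sortedE (rev_trans leq_trans)).
case/andP=> /allP ys _; rewrite inE.
by move=> /predU1P[->|/ys].
Qed.

Lemma dual_subproof n (la : Par n) : is_part n (dual_seq la).
Proof.
case: la => s /= /and3P[ss s0 /eqP <-]; apply/and3P; split.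
- apply: (homo_sorted (e := leq)); last exact: iota_sorted.
  move=> i j ij; apply: sub_count => x; exact: leq_ltn_trans.
- apply/allP=> _ /mapP[i + ->]; rewrite mem_iota add0n /= => ih.
  rewrite -has_count; apply/hasP; exists (head 0 s) => //.
  by case: {ss s0} s ih => //= y s _; rewrite inE eqxx.
- have hs x : x \in s -> x <= head 0 s by apply: sorted_geq_head.
  move: hs; rewrite /dual_seq; move: (head 0 s) => m hs; apply/eqP.
  elim: {ss s0} s hs => [|x s IHs] hs /=.
    by elim: (iota 0 m).
  rewrite -IHs; last by move=> y ys; apply: hs; rewrite inE ys orbT.
  have xm : x <= m by apply: hs; rewrite inE eqxx.
  rewrite !sumnE !big_map big_split /=; congr (_ + _).
  rewrite -{1}(subnKC xm) iotaD big_cat /=.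
  rewrite (eq_big_seq (fun=> 1)); last first.
    by move=> i; rewrite mem_iota add0n /= => ->.
  rewrite [X in _ + X]big1_seq; last first.
    move=> i /=; rewrite mem_iota add0n => /andP[xi _].
    by rewrite ltnNge xi.
  by rewrite sum1_size size_iota addn0.
Qed.

Definition dual n (la : Par n) : Par n := MkPar (dual_subproof la).

(* mu preceq la iff dual mu <=lex dual la. *)
Definition preceq n : rel (Par n) := fun mu la =>
  ((parts (dual mu) : seqlexi nat) <= (parts (dual la) : seqlexi nat))%O.

Definition prec n : rel (Par n) := fun mu la => (mu != la) && preceq mu la.

(* The simple root alpha_{j+1} is encoded by the 0-based index j : 'I_n.-1,
   and S_n acts on {0, .., n-1}: alpha_{j+1} is a right descent of w iff
   w j > w (j+1) in 0-based notation. *)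

Definition Delta n : {set 'I_n.-1} := [set: 'I_n.-1].

Definition idx0 n (j : 'I_n.-1) : 'I_n := widen_ord (leq_pred n) j.

Lemma idx1_subproof n (j : 'I_n.-1) : j.+1 < n.
Proof. by rewrite -ltn_predRL. Qed.

Definition idx1 n (j : 'I_n.-1) : 'I_n := Ordinal (idx1_subproof j).

Definition DesR n (w : 'S_n) : {set 'I_n.-1} :=
  [set j | w (idx0 j) > w (idx1 j)].

Definition DesL n (w : 'S_n) : {set 'I_n.-1} :=
  [set j | (w^-1)%g (idx0 j) > (w^-1)%g (idx1 j)].

Definition calD n (J K : {set 'I_n.-1}) : {set 'S_n} :=
  [set w | (DesL w == Delta n :\: J) && (DesR w \subset Delta n :\: K)].

(* The removed roots are alpha_{mu_1 + .. + mu_i} for 1 <= i <= k - 1. *)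
Definition J n (mu : Par n) : {set 'I_n.-1} :=
  Delta n :\: [set j : 'I_n.-1 |
    [exists i : 'I_(size mu).-1, j.+1 == sumn (take i.+1 mu)]].

Definition JJ n (la : Par n) : {set 'I_n.-1} := Delta n :\: J (dual la).

Definition A n (la mu : Par n) : nat := #|calD (JJ la) (J mu)|.

Definition Par_sorted n : #|{: Par n}|.-tuple (Par n) :=
  [tuple of sort (@preceq n) (enum {: Par n})].

Definition Amx n : 'M[nat]_#|{: Par n}| :=
  \matrix_(i, j) A (tnth (Par_sorted n) i) (tnth (Par_sorted n) j).

(* Main.v *)
(* Write r = dual la, cut the values of w into consecutive blocks ("rows") of
   sizes r_1, r_2, ... and its positions into blocks ("columns") of sizes
   mu_1, mu_2, ...  Then w lies in D(JJ_la, J_mu) iff w^-1 is decreasing on each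
   row with ascents exactly between rows, and w is increasing on each column.
   Hence rows strictly increase along a column, so a position p of offset
   off p in its column satisfies off p <= row (w p).  Counting the p with
   row (w p) < k and with off p < k yields dominance of dual la by dual mu, in
   particular dual la <=lex dual mu.  If la = mu both counts agree for all k, so
   row (w p) = off p, which forces w to sort the positions by increasing offset
   and, for equal offsets, by decreasing position; this w does belong to D. *)
Require Import Defs.
From mathcomp Require Import all_boot all_order all_fingroup all_algebra.
From mathcomp Require Import zify.

Set Implicit Arguments.
Unset Strict Implicit.
Unset Printing Implicit Defensive.

(** * Blocks of consecutive integers: block index and offset in the block *)

Lemma reshape_index_cons m s a :
  reshape_index (m :: s) a = if a < m then 0 else (reshape_index s (a - m)).+1.
Proof.
rewrite /reshape_index /= subn_eq0; case: ltnP => // ma.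
by rewrite subSn.
Qed.

Lemma reshape_offset_cons m s a :
  reshape_offset (m :: s) a = if a < m then a else reshape_offset s (a - m).
Proof.
rewrite /reshape_offset reshape_index_cons; case: ltnP => //= _.
  by rewrite subn0.
by rewrite subnDA.
Qed.

Lemma reshape_index_lt s a k : a < sumn s ->
  (reshape_index s a < k) = (a < sumn (take k s)).
Proof.
elim: s a k => // m s IHs a [|k] /=; first by rewrite ltn0.
rewrite reshape_index_cons; case: (ltnP a m) => [am|ma] as_.
  by rewrite (leq_trans am (leq_addr _ _)).
by rewrite ltnS IHs; lia.
Qed.

Lemma leq_reshape_index s a b : a <= b ->
  reshape_index s a <= reshape_index s b.
Proof. by rewrite (reshape_leq s) => /orP[/ltnW//|/andP[/eqP-> _]]. Qed.

Lemma sumn_take_reshape_index s a : sumn (take (reshape_index s a) s) <= a.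
Proof. by rewrite -[leqRHS](reshape_indexK s) leq_addr. Qed.

(** When the block changes after [a], the parts before the block of [a.+1] sum to more than [a] and
    to at most [a.+1]. *)
Lemma reshape_index_step s a : a.+1 < sumn s ->
  reshape_index s a != reshape_index s a.+1 ->
  sumn (take (reshape_index s a.+1) s) = a.+1.
Proof.
move=> as_; rewrite neq_ltn [X in _ || X]ltnNge leq_reshape_index // orbF.
rewrite reshape_index_lt; last exact: ltnW.
by move=> H; apply/eqP; rewrite eqn_leq sumn_take_reshape_index.
Qed.

Lemma reshape_offset0 s : reshape_offset s 0 = 0.
Proof. by rewrite /reshape_offset sub0n. Qed.

Lemma reshape_offsetS s a : a.+1 < sumn s ->
  reshape_offset s a.+1 =
    if reshape_index s a == reshape_index s a.+1 then (reshape_offset s a).+1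
    else 0.
Proof.
move=> as_; case: eqP => [e|/eqP ne].
  by rewrite /reshape_offset -e subSn // sumn_take_reshape_index.
by rewrite /reshape_offset (reshape_index_step as_ ne) subnn.
Qed.

Lemma sumn_take_leq s k : sumn (take k s) <= sumn s.
Proof. by rewrite -[X in _ <= sumn X](cat_take_drop k) sumn_cat leq_addr. Qed.

(** A block of size [x] has offsets [0, .., x - 1], of which [minn k x] are below [k]. *)
Lemma count_reshape_offset s k :
  count (fun a => reshape_offset s a < k) (iota 0 (sumn s)) =
  \sum_(x <- s) minn k x.
Proof.
elim: s => [|m s IHs] /=; first by rewrite big_nil.
rewrite iotaD count_cat big_cons add0n.
rewrite (_ : iota m _ = map (addn m) (iota 0 (sumn s))); last first.
  by rewrite -iotaDl addn0.
rewrite count_map -IHs; congr (_ + _); last first.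
  apply: eq_count => a /=.
  by rewrite reshape_offset_cons [m + a < m]ltnNge leq_addr addKn.
rewrite (@eq_in_count _ _ (fun a => a < k)); last first.
  by move=> a; rewrite mem_iota /= add0n reshape_offset_cons => ->.
elim: m => [|m IHm]; first by rewrite minn0.
rewrite -[m.+1]addn1 iotaD count_cat IHm /= add0n; lia.
Qed.

(** * Dual partitions, dominance and the lexicographic order *)

Lemma nth_dual_seq s i : sorted geq s ->
  nth 0 (dual_seq s) i = count (fun x => i < x) s.
Proof.
move=> ss; rewrite /dual_seq; case: (ltnP i (head 0 s)) => hi.
  by rewrite (nth_map 0) ?size_iota // nth_iota.
rewrite nth_default ?size_map ?size_iota //; apply/esym/eqP.
rewrite -leqn0 leqNgt -has_count; apply/hasPn => x xs.
by rewrite -leqNgt (leq_trans (sorted_geq_head ss xs)).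
Qed.

Lemma sumn_take_nth s k : sumn (take k s) = \sum_(i < k) nth 0 s i.
Proof.
elim: k s => [|k IHk] [|x s]; rewrite ?big_ord0 //=.
  by rewrite big1 // => i _; rewrite nth_nil.
by rewrite big_ord_recl IHk.
Qed.

(** Both sides count the cells in the first [k] columns of the Young diagram of [s], by columns and
    by rows. *)
Lemma sumn_take_dual_seq s k : sorted geq s ->
  sumn (take k (dual_seq s)) = \sum_(x <- s) minn k x.
Proof.
move=> ss; rewrite sumn_take_nth.
transitivity (\sum_(i < k) \sum_(x <- s) (i < x : nat)).
  by apply: eq_bigr => i _; rewrite nth_dual_seq // -sum1_count big_mkcond.
rewrite exchange_big; apply: eq_bigr => x _ /=.
elim: k => [|k IHk]; first by rewrite big_ord0 minnC minn0.
rewrite big_ord_recr IHk /= /minn {IHk}.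
by case: (ltnP k x); case: (ltnP k.+1 x) => /=; lia.
Qed.

(** At the first index where the sequences differ, the partial sums decide. Positivity of [s]
    excludes that [t] is a proper prefix of [s]. *)
Lemma seqlexi_dominance (s t : seq nat) : all (fun x => 0 < x) s ->
  (forall k, sumn (take k s) <= sumn (take k t)) ->
  ((s : seqlexi nat) <= (t : seqlexi nat))%O.
Proof.
elim: s t => [|x s IHs] t //= /andP[x0 s0] H.
case: t H => [|y t] H.
  by move: (H 1); rewrite /= take0; lia.
rewrite Order.SeqLexiOrder.Exports.lexi_cons !leEnat.
have := H 1; rewrite /= !take0 /= !addn0 => xy; rewrite xy /=.
apply/implyP => yx; apply: IHs => // k.
by have := H k.+1; rewrite /=; lia.
Qed.

Lemma part_sumn n (la : Par n) : sumn la = n.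
Proof. by case/and3P: (valP la) => _ _ /eqP. Qed.

Lemma part_sorted n (la : Par n) : sorted geq la.
Proof. by case/and3P: (valP la). Qed.

Lemma part_pos n (la : Par n) : all (fun x => 0 < x) la.
Proof. by case/and3P: (valP la). Qed.

(** The multiplicity of a part [i.+1] is the difference of two consecutive entries of the dual. *)
Lemma dual_inj n : injective (@dual n).
Proof.
move=> la mu /(congr1 (@parts n)) /= e; apply: val_inj => /=.
have ec i : count (fun x => i < x) la = count (fun x => i < x) mu.
  by rewrite -!nth_dual_seq ?part_sorted // e.
apply: (sorted_eq (leT := geq)); rewrite ?part_sorted //.
- by move=> x y z /= xy yz; exact: leq_trans yz xy.
- by move=> x y /= /andP[yx xy]; apply/eqP; rewrite eqn_leq xy yx.
have split_count (s : seq nat) i : count (fun x => i < x) s =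
    count_mem i.+1 s + count (fun x => i.+1 < x) s.
  by elim: s => //= x s ->; lia.
apply/allP => -[|x] _ /=; last first.
  have := ec x; rewrite (split_count la) (split_count mu) ec.
  by move=> /addIn ->.
have nz (nu : Par n) : 0 \notin parts nu.
  by apply/negP => /(allP (part_pos nu)).
by rewrite !(count_memPn _) ?nz.
Qed.

(** * Descent conditions read on blocks *)

Lemma mem_J n (mu : Par n) (j : 'I_n.-1) :
  (j \in J mu) = (reshape_index mu j == reshape_index mu j.+1).
Proof.
have jn : j.+1 < sumn mu by rewrite part_sumn idx1_subproof.
rewrite !inE andbT; apply/idP/idP => [|/eqP e]; last first.
  apply/existsP => -[i /eqP je].
  have := reshape_index_lt i.+1 jn; rewrite -je ltnn -e.
  by rewrite reshape_index_lt ?(ltnW jn) // -je ltnSn.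
apply: contraNT => ne; have je := reshape_index_step jn ne.
(* The block starting at [j.+1] yields the witness. Its index is decremented because [J] takes
   [i.+1] parts, which is possible since block [0] starts at [0]. *)
have lt : 0 < reshape_index mu j.+1.
  by move: je; case: (reshape_index _ _) => //; rewrite take0.
have ls := reshape_indexP jn.
have im : (reshape_index mu j.+1).-1 < (size mu).-1 by lia.
by apply/existsP; exists (Ordinal im); rewrite /= prednK // je.
Qed.

Lemma ordS_ind n (P : 'I_n -> Prop) :
  (forall p : 'I_n, p = 0 :> nat -> P p) ->
  (forall j : 'I_n.-1, P (idx0 j) -> P (idx1 j)) -> forall p, P p.
Proof.
move=> P0 PS [p pn]; elim: p pn => [|p IHp] pn; first exact: P0.
have pn1 : p < n.-1 by rewrite ltn_predRL.
have -> : Ordinal pn = idx1 (Ordinal pn1) by apply: val_inj.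
apply: PS; have -> : idx0 (Ordinal pn1) = Ordinal (ltnW pn) by apply: val_inj.
exact: IHp.
Qed.

(** The complement of [JJ la] is [J (dual la)], so the left descents are exactly the pairs inside
    one row. The right descent condition is an inclusion, hence only an implication. *)
Lemma calDP n (la mu : Par n) (w : 'S_n) :
  reflect
    ((forall j : 'I_n.-1, ((w^-1)%g (idx1 j) < (w^-1)%g (idx0 j)) =
        (reshape_index (dual la) j == reshape_index (dual la) j.+1)) /\
     (forall j : 'I_n.-1, reshape_index mu j = reshape_index mu j.+1 ->
        w (idx0 j) < w (idx1 j)))
    (w \in calD (JJ la) (J mu)).
Proof.
rewrite inE /JJ /Delta !setTD setCK.
apply: (iffP andP) => [[/eqP/setP eL /subsetP sR]|[eL sR]]; split.
- by move=> j; have := eL j; rewrite inE mem_J.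
- move=> j e; rewrite ltn_neqAle; apply/andP; split.
    by rewrite (inj_eq val_inj) (inj_eq perm_inj) -(inj_eq val_inj) /= ltn_eqF.
  rewrite leqNgt; apply/negP => h; have := sR j.
  by rewrite [_ \in DesR w]inE in_setC mem_J e eqxx => /(_ h).
- by apply/eqP/setP => j; rewrite inE mem_J.
- apply/subsetP => j; rewrite [_ \in DesR w]inE in_setC mem_J => h.
  by apply/eqP => /sR; rewrite ltnNge ltnW.
Qed.

Arguments calDP {n la mu w}.

(** * Permutations as rankings of positions *)

Lemma card_ord_lt n m : m <= n -> #|[set a : 'I_n | a < m]| = m.
Proof.
by move=> mn; rewrite -sum1dep_card (big_ord_narrow mn) sum1_card card_ord.
Qed.

Lemma perm_rank n (w : 'S_n) p : #|[set q | w q < w p]| = w p.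
Proof.
rewrite -[RHS](card_ord_lt (ltnW (ltn_ord (w p)))).
rewrite -[RHS](card_preimset _ (@perm_inj _ w)).
by apply: eq_card => q; rewrite !inE.
Qed.

Lemma perm_ltn_inj n (v w : 'S_n) :
  (forall p q, (v p < v q) = (w p < w q)) -> v = w.
Proof.
move=> e; apply/permP => p; apply: val_inj.
rewrite /= -[LHS]perm_rank -[RHS]perm_rank.
by apply: eq_card => q; rewrite !inE e.
Qed.

(** The permutation sends [p] to the number of its predecessors for [r]. *)
Lemma perm_of_order n (r : rel 'I_n) : irreflexive r -> transitive r ->
  (forall p q, p != q -> r p q || r q p) ->
  exists w : 'S_n, forall p q, (w p < w q) = r p q.
Proof.
move=> rr rt rtot.
pose down p := [set q | r q p].
have card_down p q : r p q -> #|down p| < #|down q|.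
  move=> pq; apply/proper_card/properP; split.
    by apply/subsetP => x; rewrite !inE => /rt; apply.
  by exists p; rewrite !inE ?rr.
have down_lt p : #|down p| < n.
  rewrite -[ltnRHS]card_ord -cardsT; apply/proper_card/properP.
  by split; [apply/subsetP => ? | exists p; rewrite !inE ?rr].
pose f p := Ordinal (down_lt p).
have f_inj : injective f.
  move=> p q /(congr1 val) /= e; apply/eqP/negPn/negP => /rtot.
  by case/orP => /card_down; rewrite e ltnn.
exists (perm f_inj) => p q; rewrite !permE /=.
apply/idP/idP => [lt|/card_down //].
have /rtot/orP[//|/card_down] : p != q.
  by apply: contraTneq lt => ->; rewrite ltnn.
by rewrite ltnNge ltnW.
Qed.

(** * Offsets against rows, and the resulting dominance *)

Section InverseDecreasing.
Variables (n : nat) (la mu : Par n) (w : 'S_n).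
Hypothesis Dw : w \in calD (JJ la) (J mu).

Local Notation row a := (reshape_index (dual la) a).
Local Notation off p := (reshape_offset mu p).

Lemma calD_inv_decr (a b : 'I_n) : a < b -> row a = row b ->
  (w^-1)%g b < (w^-1)%g a.
Proof.
have [eL _] := calDP Dw.
elim/ordS_ind: b => [b -> //|j IHj /=]; rewrite ltnS => aj e.
have rj : row a = row j.
  by apply/eqP; rewrite eqn_leq leq_reshape_index //= e leq_reshape_index.
have lt : (w^-1)%g (idx1 j) < (w^-1)%g (idx0 j) by rewrite eL -rj e.
move: aj; rewrite leq_eqVlt => /predU1P[aj|aj].
  by rewrite (_ : a = idx0 j) //; apply: val_inj.
exact: ltn_trans lt (IHj aj rj).
Qed.

Lemma calD_decr (p q : 'I_n) : p < q -> row (w p) = row (w q) -> w q < w p.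
Proof.
move=> pq e; case: (ltngtP (w p) (w q)) => // h.
  by have := calD_inv_decr h e; rewrite !permK ltnNge ltnW.
by move: pq; rewrite (perm_inj (val_inj h)) ltnn.
Qed.

(** Down a column [w] increases, so the row cannot drop; it cannot stay the same either, since
    within a row [w] decreases with the position. *)
Lemma calD_offset_leq (p : 'I_n) : off p <= row (w p).
Proof.
have [_ iR] := calDP Dw.
elim/ordS_ind: p => [p -> |j IHj]; first by rewrite reshape_offset0.
rewrite reshape_offsetS ?part_sumn ?idx1_subproof //; case: eqP => // /iR lt.
apply: leq_ltn_trans IHj _; rewrite ltn_neqAle leq_reshape_index ?(ltnW lt) //.
rewrite andbT; apply/eqP => e.
by have := @calD_decr (idx0 j) (idx1 j) (ltnSn j) e; rewrite ltnNge (ltnW lt).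
Qed.

Lemma card_offset k :
  #|[set p : 'I_n | off p < k]| = sumn (take k (dual mu)).
Proof.
rewrite sumn_take_dual_seq ?part_sorted // -count_reshape_offset part_sumn.
by rewrite cardsE cardE size_filter -val_enum_ord count_map enumT.
Qed.

Lemma card_row k :
  #|[set p : 'I_n | row (w p) < k]| = sumn (take k (dual la)).
Proof.
have le_n : sumn (take k (dual la)) <= n.
  by rewrite -[leqRHS](part_sumn (dual la)) sumn_take_leq.
rewrite -[RHS](card_ord_lt le_n) -[RHS](card_preimset _ (@perm_inj _ w)).
by apply: eq_card => p; rewrite !inE reshape_index_lt ?part_sumn.
Qed.

Lemma calD_row_sub k :
  [set p : 'I_n | row (w p) < k] \subset [set p : 'I_n | off p < k].
Proof.
by apply/subsetP => p; rewrite !inE; apply/leq_ltn_trans/calD_offset_leq.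
Qed.

Lemma calD_preceq : preceq la mu.
Proof.
apply: seqlexi_dominance => [|k]; first exact: part_pos.
by rewrite -card_row -card_offset subset_leq_card // calD_row_sub.
Qed.

End InverseDecreasing.

(** * The diagonal case: existence and uniqueness *)

Lemma calD_row_offset n (la : Par n) (w : 'S_n) (p : 'I_n) :
  w \in calD (JJ la) (J la) ->
  reshape_index (dual la) (w p) = reshape_offset la p.
Proof.
move=> Dw; apply/eqP; rewrite eqn_leq calD_offset_leq // andbT -ltnS.
(* These nested sets have equal cardinality, as both partitions are [la], so they coincide; [p] lies
   in the offset set for this threshold. *)
have /subset_leqif_cards [_] := calD_row_sub Dw (reshape_offset la p).+1.
rewrite card_row card_offset eqxx => /esym/eqP/setP/(_ p).
by rewrite !inE ltnSn => ->.
Qed.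

Definition off_lt (s : seq nat) : rel nat := fun p q =>
  (reshape_offset s p < reshape_offset s q) ||
  (reshape_offset s p == reshape_offset s q) && (q < p).


Lemma off_lt_irr s : irreflexive (off_lt s).
Proof. by move=> p; rewrite /off_lt !ltnn andbF. Qed.

Lemma off_lt_trans s : transitive (off_lt s).
Proof. by move=> q p r; rewrite /off_lt; lia. Qed.

Lemma off_lt_total s p q : p != q -> off_lt s p q || off_lt s q p.
Proof. by rewrite /off_lt; lia. Qed.

Lemma calD_ltn n (la : Par n) (w : 'S_n) (p q : 'I_n) :
  w \in calD (JJ la) (J la) -> (w p < w q) = off_lt la p q.
Proof.
move=> Dw.
have lt (p' q' : 'I_n) : off_lt la p' q' -> w p' < w q'.
  rewrite /off_lt -!(calD_row_offset _ Dw); case/orP => [|/andP[/eqP e]].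
    by apply: contraTT; rewrite -!leqNgt; apply: leq_reshape_index.
  by move/(calD_decr Dw); apply.
apply/idP/idP => [pq|/lt //].
have /(off_lt_total la)/orP[//|/lt] : p != q :> nat.
  by apply: contraTneq pq => /val_inj ->; rewrite ltnn.
by rewrite ltnNge ltnW.
Qed.

(** An offset is less than some part, hence less than the first and largest one, and on the first
    block the offset is the identity. *)
Lemma reshape_offset_idem s a : sorted geq s -> a < sumn s ->
  reshape_offset s (reshape_offset s a) = reshape_offset s a.
Proof.
move=> ss as_; have := reshape_offsetP as_.
have /(mem_nth 0)/(sorted_geq_head ss) := reshape_indexP as_.
move=> h /leq_trans/(_ h).
by case: s {ss as_ h} => [|m s] //= h; rewrite [LHS]reshape_offset_cons h.
Qed.

Section OffsetOrder.
Variables (n : nat) (la : Par n) (w : 'S_n).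
Hypothesis w_ltn : forall p q : 'I_n, (w p < w q) = off_lt la p q.

Local Notation off p := (reshape_offset la p).

Lemma row_off_lt (p : 'I_n) : reshape_index (dual la) (w p) = off p.
Proof.
have rk : w p = #|[set q : 'I_n | off_lt la q p]| :> nat.
  by rewrite -perm_rank; apply: eq_card => q; rewrite !inE w_ltn.
(* The positions of offset below [k] form an initial segment for [off_lt], whose size is the total
   of the first [k] rows; [w p] is the rank of [p]. *)
have lt k : (reshape_index (dual la) (w p) < k) = (off p < k).
  rewrite reshape_index_lt ?part_sumn // -(card_offset la) rk.
  case: (ltnP (off p)) => pk; last first.
    apply/negbTE; rewrite -leqNgt subset_leq_card //.
    by apply/subsetP => q; rewrite !inE /off_lt => /leq_trans -> .
  apply/proper_card/properP; split.
    by apply/subsetP => q; rewrite !inE /off_lt; lia.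
  by exists p; rewrite !inE ?off_lt_irr.
by apply/eqP; rewrite eqn_leq -ltnS lt ltnSn leqNgt lt -leqNgt /=.
Qed.

Lemma off_lt_calD : w \in calD (JJ la) (J la).
Proof.
apply/calDP; split=> j; last first.
  move=> e; rewrite w_ltn /off_lt reshape_offsetS ?part_sumn ?idx1_subproof //.
  by rewrite e eqxx ltnSn.
have /(congr1 val) /= wp := permKV w (idx0 j).
have /(congr1 val) /= wq := permKV w (idx1 j).
set p := (w^-1)%g (idx0 j) in wp *; set q := (w^-1)%g (idx1 j) in wq *.
have pq : off_lt la p q by rewrite -w_ltn wp wq.
rewrite -wq -{1}wp !row_off_lt.
case: eqP pq => [e|/eqP ne]; rewrite /off_lt.
  by rewrite e ltnn eqxx.
(* At a row boundary [p <= q] must hold; it will follow from [p = off p < off q <= q]. *)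
rewrite (negbTE ne) orbF => lt; apply/negbTE; rewrite -leqNgt.
have op : off p <= p by apply: leq_subr.
have oq : off q <= q by apply: leq_subr.
(* The first position of offset [off p] is [off p] itself, as the first part
   is the largest; [p] is that position, being last for [off_lt] there. *)
pose p0 := Ordinal (leq_ltn_trans op (ltn_ord p)).
have op0 : off p0 = off p by rewrite reshape_offset_idem ?part_sorted ?part_sumn.
suff -> : (p : nat) = off p by apply: leq_trans (ltnW lt) oq.
apply/eqP; rewrite eqn_leq op andbT leqNgt; apply/negP => p0p.
(* If [p0 < p], then [w p0] would lie strictly between the consecutive values [w p] and [w q]. *)
have : w p < w p0 by rewrite w_ltn /off_lt op0 ltnn eqxx.
have : w p0 < w q by rewrite w_ltn /off_lt op0 lt.
by rewrite wp wq; lia.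
Qed.

End OffsetOrder.

Lemma calD_diag n (la : Par n) :
  exists w : 'S_n, calD (JJ la) (J la) = [set w].
Proof.
have [|||w wE] := @perm_of_order n (off_lt la).
- by move=> p; apply: off_lt_irr.
- by move=> q p r; apply: off_lt_trans.
- by move=> p q; apply: off_lt_total.
exists w; apply/setP => v; rewrite in_set1; apply/idP/eqP => [Dv|->].
  by apply: perm_ltn_inj => p q; rewrite wE; apply: calD_ltn.
exact: off_lt_calD.
Qed.

(** * The order on partitions and triangularity *)

Lemma preceq_total n : total (@preceq n).
Proof. by move=> la mu; apply: Order.TotalTheory.le_total. Qed.

Lemma preceq_trans n : transitive (@preceq n).
Proof. by move=> la mu nu; apply: Order.POrderTheory.le_trans. Qed.

Lemma preceq_anti n : antisymmetric (@preceq n).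
Proof.
move=> la mu h; apply: dual_inj; apply: val_inj.
exact: (Order.POrderTheory.le_anti h).
Qed.

Lemma calD_prec n (la mu : Par n) : prec mu la -> calD (JJ la) (J mu) = set0.
Proof.
case/andP=> ne le; apply/eqP; rewrite -subset0; apply/subsetP => w Dw.
by case/eqP: ne; apply: preceq_anti; rewrite le (calD_preceq Dw).
Qed.

Lemma Par_sorted_prec n (i j : 'I_#|{: Par n}|) :
  i < j -> prec (tnth (Par_sorted n) i) (tnth (Par_sorted n) j).
Proof.
move=> ij; pose x0 := tnth (Par_sorted n) i.
rewrite !(tnth_nth x0) /prec nth_uniq ?size_tuple //; last first.
  by rewrite sort_uniq enum_uniq.
rewrite neq_ltn ij /= (sorted_ltn_nth (@preceq_trans n)) ?inE ?size_tuple //.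
exact/sort_sorted/preceq_total.
Qed.

Theorem theorem4p5 (n : nat) (hn : 1 <= n) :
  [/\ (* preceq is a total order on Par(n) *)
      [/\ total (@preceq n), transitive (@preceq n)
        & antisymmetric (@preceq n)],
      (* is_trig_mx means lower triangular, hence the transpose *)
      is_trig_mx (Amx n)^T /\ (forall i, Amx n i i = 1),
      forall la mu : Par n, prec mu la ->
        calD (JJ la) (J mu) = set0 /\ A la mu = 0
    & forall la : Par n,
        (exists w : 'S_n, calD (JJ la) (J la) = [set w]) /\ A la la = 1].
Proof.
have A0 la mu : prec mu la -> A la mu = 0.
  by move=> lt; rewrite /A calD_prec // cards0.
have A1 la : A la la = 1.
  by rewrite /A; have [w ->] := calD_diag la; rewrite cards1.
split.
- by split; [apply: preceq_total | apply: preceq_trans | apply: preceq_anti].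
- split=> [|i]; last by rewrite mxE.
  by apply/is_trig_mxP => i j ij; rewrite !mxE A0 // Par_sorted_prec.
- by move=> la mu lt; rewrite calD_prec // A0.
- by move=> la; split=> //; apply: calD_diag.
Qed.
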